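(* Let $n\ge 2$ and let $D\in\mathbb{R}^{n\times n}$ satisfy $\operatorname{vec}(D)\in\operatorname{null}(A)$. Then $D$ has a conformal realization $$D=D^{(1)}+D^{(2)}+\cdots+D^{(s)},$$ where $D^{(1)},\dots,D^{(s)}$ are elementary matrices of $\operatorname{null}(A)$ and each $D^{(i)}$ is conformal to $D$ (for $D=0$ this is the empty sum, $s=0$). In particular, $D^{(i)}\in\mathcal{E}_A$ for all $i=1,\dots,s$. Therefore, $\mathcal{E}_A$ includes all the elementary matrices of $\operatorname{null}(A)$.
   Context: For $X\in\mathbb{R}^{n\times n}$, $\operatorname{vec}(X)\in\mathbb{R}^{n^2}$ is the vector obtained by stacking the columns $X(:,1),\dots,X(:,n)$. The matrix $A\in\mathbb{R}^{2n\times n^2}$ is $$A=\begin{pmatrix} I_n & I_n & \cdots & I_n\\ \mathbf 1_n^T & & & \\ & \mathbf 1_n^T & & \\ & & \ddots & \\ & & & \mathbf 1_n^T\end{pmatrix}\quad(n\text{ column blocks}),$$ where $I_n$ is the identity and $\mathbf 1_n\in\mathbb{R}^n$ the all-ones vector; thus $\operatorname{vec}(X)\in\operatorname{null}(A)$ iff all row sums and all column sums of $X$ are zero. A vector $\bar d$ is conformal to $d$ if $\operatorname{supp}(\bar d)\subseteq\operatorname{supp}(d)$ and $\bar d_id_i\ge0$ for all $i$, where $\operatorname{supp}$ is the set of indices of nonzero entries; a matrix is conformal to another if their vectorizations are. A nonzero $d\in\operatorname{null}(A)$ is an elementary vector of $\operatorname{null}(A)$ if there is no nonzero $d'\in\operatorname{null}(A)$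 conformal to $d$ with $\operatorname{supp}(d')\ne\operatorname{supp}(d)$. A nonzero matrix $X$ is an elementary matrix of $\operatorname{null}(A)$ if $\operatorname{vec}(X)$ is an elementary vector of $\operatorname{null}(A)$. For $2\le t\le n$, let $E^t\in\mathbb{R}^{n\times n}$ be the matrix with $E^t(i,i)=1$ for $1\le i\le t$, $E^t(i+1,i)=-1$ for $1\le i\le t-1$, $E^t(1,t)=-1$, and all other entries zero. $\mathcal{E}_A$ is the set of nonzero $X\in\mathbb{R}^{n\times n}$ that, after some row permutation and some column permutation, are a scalar multiple of one of $E^2,\dots,E^n$. *)

(* Defs.v *)
From HB Require Import structures.
From mathcomp Require Import all_boot all_order all_algebra all_fingroup.
From mathcomp Require Import reals.

Set Implicit Arguments.
Unset Strict Implicit.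
Unset Printing Implicit Defensive.

Import Order.TTheory GRing.Theory Num.Theory.
Local Open Scope ring_scope.

(* The type 'cV_(\sum_(j < n) n) is R^(n^2) split into n blocks of size n. *)
Definition vec (R : realType) (n : nat) (X : 'M[R]_n) :
    'cV[R]_(\sum_(j < n) n) :=
  \mxcol_(j < n) col j X.

Definition constraint_mx (R : realType) (n : nat) :
    'M[R]_(n + \sum_(i < n) 1, \sum_(j < n) n) :=
  col_mx (\mxrow_(j < n) (1%:M : 'M[R]_n))
         (\mxblock_(i < n, j < n)
            (if i == j then const_mx 1 else 0 : 'rV[R]_n)).

Definition in_null (R : realType) (m k : nat) (A : 'M[R]_(m, k))
    (d : 'cV[R]_k) : Prop :=
  A *m d = 0.

Definition supp (R : realType) (k : nat) (d : 'cV[R]_k) : {set 'I_k} :=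
  [set i | d i 0 != 0].

Definition conformal (R : realType) (k : nat) (d' d : 'cV[R]_k) : Prop :=
  supp d' \subset supp d /\ forall i, 0 <= d' i 0 * d i 0.

Definition conformal_mx (R : realType) (n : nat) (X Y : 'M[R]_n) : Prop :=
  conformal (vec X) (vec Y).

Definition elementary_vector (R : realType) (m k : nat) (A : 'M[R]_(m, k))
    (d : 'cV[R]_k) : Prop :=
  [/\ d != 0, in_null A d &
      ~ (exists d' : 'cV[R]_k,
           [/\ d' != 0, in_null A d', conformal d' d & supp d' != supp d])].

Definition elementary_matrix (R : realType) (n : nat) (X : 'M[R]_n) : Prop :=
  X != 0 /\ elementary_vector (constraint_mx R n) (vec X).

(* Indices are 0-based here: the diagonal ones are at (i, i) for i < t, the
   subdiagonal -1's at (j + 1, j) for j + 1 < t, the corner -1 at (0, t - 1).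
   These positions are pairwise distinct when 2 <= t. *)
Definition cycle_mx (R : realType) (n t : nat) : 'M[R]_n :=
  \matrix_(i < n, j < n)
    if (i == j) && (i < t)%N then 1
    else if (i == j.+1 :> nat) && (j.+1 < t)%N then -1
    else if (i == 0%N :> nat) && (j.+1 == t) then -1
    else 0.

Definition in_cycle_family (R : realType) (n : nat) (X : 'M[R]_n) : Prop :=
  X != 0 /\
  exists (t : nat) (p q : 'S_n) (c : R),
    (2 <= t <= n)%N /\ row_perm p (col_perm q X) = c *: cycle_mx R n t.

(* Main.v *)
Require Import Defs.
From HB Require Import structures.
From mathcomp Require Import all_boot all_order all_algebra all_fingroup.
From mathcomp Require Import boolp reals.
From mathcomp Require Import zify.

Set Implicit Arguments.
Unset Strict Implicit.
Unset Printing Implicit Defensive.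

Import Order.TTheory GRing.Theory Num.Theory.
Local Open Scope ring_scope.

(* Subtracting from d the largest multiple of a conformal null vector that
   keeps all signs kills at least one entry.  By induction on the support, every
   nonzero null vector has an elementary vector conformal to it, and removing
   suitable multiples of such vectors one after another decomposes it.
   For the constraint matrix, a row with a nonzero entry has a positive entry, and
   the column of that entry has a negative one, in another row; iterating this row
   map reaches a periodic orbit, that is, a permuted cycle matrix C conformal to
   the given matrix.  If X is elementary, X - e C has smaller support for
   a suitable e, so it vanishes and X = e C. *)

(** * Conformality and elementary vectors of an arbitrary null space *)

Lemma conformalP (R : realType) k (x d : 'cV[R]_k) :
  conformal x d <->
  (forall i, d i 0 = 0 -> x i 0 = 0) /\ (forall i, 0 <= x i 0 * d i 0).
Proof.
split=> -[supp_xd xd_ge0]; split=> //.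
  move=> i /eqP di0; apply/eqP; apply: contraTT di0 => xi0.
  by have := subsetP supp_xd i; rewrite !inE => ->.
by apply/subsetP=> i; rewrite !inE; apply: contra => /eqP /supp_xd ->.
Qed.

Lemma conformal_refl (R : realType) k (d : 'cV[R]_k) : conformal d d.
Proof. by apply/conformalP; split=> // i; rewrite -expr2 sqr_ge0. Qed.

Lemma conformal_trans (R : realType) k (y x z : 'cV[R]_k) :
  conformal x y -> conformal y z -> conformal x z.
Proof.
move=> /conformalP[xy0 xy_ge0] /conformalP[yz0 yz_ge0].
apply/conformalP; split=> [i /yz0/xy0 //|i].
have [/xy0 ->|yi_neq0] := eqVneq (y i 0) 0; first by rewrite mul0r.
(* The sign passes through [y]: the square is positive, and the product regroups into two factors
   that are nonnegative by hypothesis. *)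
have: 0 <= (x i 0 * z i 0) * y i 0 ^+ 2.
  by rewrite expr2 mulrACA [z i 0 * _]mulrC mulr_ge0.
by rewrite pmulr_lge0 // exprn_even_gt0.
Qed.

Lemma suppZ (R : realType) k (e : R) (x : 'cV[R]_k) :
  e != 0 -> supp (e *: x) = supp x.
Proof. by move=> e0; apply/setP=> i; rewrite !inE mxE mulf_eq0 negb_or e0. Qed.

Lemma conformalZ (R : realType) k (e : R) (x : 'cV[R]_k) :
  0 < e -> conformal (e *: x) x.
Proof.
move=> e_gt0; split=> [|i]; first by rewrite suppZ ?gt_eqF.
by rewrite mxE -mulrA -expr2 mulr_ge0 ?sqr_ge0 ?ltW.
Qed.

Lemma conformal_scaler (R : realType) k (e : R) (y x : 'cV[R]_k) :
  0 < e -> conformal y (e *: x) -> conformal y x.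
Proof. by move=> e_gt0 /conformal_trans; apply; exact: conformalZ. Qed.

Lemma elementary_vectorZ (R : realType) m k (A : 'M[R]_(m, k)) (e : R) x :
  0 < e -> elementary_vector A x -> elementary_vector A (e *: x).
Proof.
move=> e_gt0 [x_neq0 Ax0 minx]; have e_neq0 : e != 0 by rewrite gt_eqF.
split; first by rewrite scaler_eq0 negb_or e_neq0.
  by rewrite /in_null -scalemxAr Ax0 scaler0.
move=> [y [y_neq0 Ay0 cy]]; rewrite suppZ // => suppy.
by apply: minx; exists y; split=> //; apply: conformal_scaler cy.
Qed.

(* [e] is the least ratio [d i / x i]: the largest multiple of [x] that can be
   removed from [d] without changing a sign. *)
Lemma conformal_sub (R : realType) k (x d : 'cV[R]_k) :
  x != 0 -> conformal x d ->
  exists2 e : R, 0 < e &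
    conformal (d - e *: x) d /\ supp (d - e *: x) \proper supp d.
Proof.
move=> x_neq0 /conformalP[xd0 xd_ge0].
have [i0 xi0] : exists i, x i 0 != 0.
  apply/existsP; apply: contraR x_neq0 => /existsPn x0.
  by apply/eqP/colP=> i; rewrite mxE; apply/eqP; rewrite -[_ == _]negbK.
have [j xj min_j] :=
  @Order.TotalTheory.arg_minP _ _ _ i0 (fun i => x i 0 != 0) (fun i => d i 0 / x i 0) xi0.
set e := d j 0 / x j 0.
have d_neq0 i : x i 0 != 0 -> d i 0 != 0 by apply: contra => /eqP/xd0 ->.
have e_gt0 : 0 < e.
  rewrite lt_def mulf_neq0 ?invr_neq0 ?d_neq0 //=.
  have -> : e = x j 0 * d j 0 / x j 0 ^+ 2.
    by rewrite /e expr2 invfM mulrACA divff // mul1r.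
  by rewrite divr_ge0 ?sqr_ge0.
have conf : conformal (d - e *: x) d.
  apply/conformalP; split=> [i di0|i]; first by rewrite !mxE di0 xd0 // mulr0 subr0.
  rewrite !mxE; have [xi_eq0|xi_neq0] := eqVneq (x i 0) 0.
    by rewrite xi_eq0 mulr0 subr0 -expr2 sqr_ge0.
  (* The choice of [e] as least ratio makes the first factor nonnegative, and [x i 0] agrees in sign
     with [d i 0]. *)
  have -> : d i 0 - e * x i 0 = (d i 0 / x i 0 - e) * x i 0.
    by rewrite mulrBl divfK.
  by rewrite -mulrA mulr_ge0 // subr_ge0 min_j.
exists e => //; split=> //; case: conf => sub_supp _.
apply/properP; split=> //; exists j; rewrite !inE ?d_neq0 // negbK !mxE.
by rewrite divfK // subrr.
Qed.

Lemma in_nullB (R : realType) m k (A : 'M[R]_(m, k)) (e : R) d x :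
  in_null A d -> in_null A x -> in_null A (d - e *: x).
Proof. by rewrite /in_null mulmxBr -scalemxAr => -> ->; rewrite scaler0 subrr. Qed.

(** When minimality of [d] fails, the offending [y] has strictly smaller support, since conformality
    already gives the inclusion; the induction applies to [y]. *)
Lemma exists_conformal_elementary (R : realType) m k (A : 'M[R]_(m, k)) d :
  d != 0 -> in_null A d -> exists2 x, elementary_vector A x & conformal x d.
Proof.
have [r] := ubnP #|supp d|; elim: r d => // r IHr d le_d d_neq0 Ad0.
have [[y [y_neq0 Ay0 yd neq_supp]]|minimal] := pselect (exists y,
  [/\ y != 0, in_null A y, conformal y d & supp y != supp d]); last first.
  by exists d => //; exact: conformal_refl.
have [|//|//|x x_elem xy] := IHr y.
  apply: leq_trans (proper_card _) (_ : #|supp d| <= r)%N => //.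
  by rewrite properEneq neq_supp; case: yd.
by exists x => //; apply: conformal_trans xy yd.
Qed.

(** The remainder is itself conformal to [d], so its pieces are conformal to [d] by transitivity.
    The last clause records the empty sum for the zero vector. *)
Lemma conformal_realization (R : realType) m k (A : 'M[R]_(m, k)) d :
  in_null A d ->
  exists xs : seq 'cV[R]_k,
    [/\ d = \sum_(x <- xs) x,
        forall x, x \in xs -> elementary_vector A x /\ conformal x d &
        d = 0 -> xs = [::]].
Proof.
have [r] := ubnP #|supp d|; elim: r d => // r IHr d le_d Ad0.
have [->|d_neq0] := eqVneq d 0; first by exists [::]; rewrite big_nil.
have [x x_elem xd] := exists_conformal_elementary d_neq0 Ad0.
have [x_neq0 Ax0 _] := x_elem.
have [e e_gt0 [dx_d dx_proper]] := conformal_sub x_neq0 xd.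
have [||xs [sum_xs xs_elem _]] := IHr (d - e *: x).
- exact: leq_trans (proper_card dx_proper) _.
- exact: in_nullB.
exists (e *: x :: xs); split; last by move/eqP: d_neq0.
  by rewrite big_cons -sum_xs addrC subrK.
move=> y; rewrite inE => /predU1P[->|/xs_elem[y_elem y_dx]].
  by split; [exact: elementary_vectorZ | apply: conformal_trans xd; exact: conformalZ].
by split=> //; apply: conformal_trans dx_d.
Qed.

(** * Vectorization, and the null space in terms of row and column sums *)

(** The column index comes first in [Rank], because the blocks of [vec] are the columns. *)
Definition vec_index n (i j : 'I_n) : 'I_(\sum_(j < n) n) :=
  @tagnat.Rank n (fun=> n) j i.

Lemma vecE (R : realType) n (X : 'M[R]_n) i j :
  vec X (vec_index i j) 0 = X i j.
Proof.
have /matrixP/(_ i 0) : submxcol (vec X) j = col j X by rewrite mxcolK.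
by rewrite !mxE.
Qed.

Lemma vec_ind (n : nat) (P : 'I_(\sum_(j < n) n) -> Prop) :
  (forall i j, P (vec_index i j)) -> forall k, P k.
Proof. by move=> P_index k; rewrite -(tagnat.sig2K k); apply: P_index. Qed.

Lemma vec_inj (R : realType) n : injective (@vec R n).
Proof. by move=> X Y eqXY; apply/matrixP=> i j; rewrite -!vecE eqXY. Qed.

Lemma vec0 (R : realType) n : vec (0 : 'M[R]_n) = 0.
Proof. by apply/colP=> k; elim/vec_ind: k => i j; rewrite vecE !mxE. Qed.

Definition unvec (R : realType) n (d : 'cV[R]_(\sum_(j < n) n)) : 'M[R]_n :=
  \matrix_(i, j) d (vec_index i j) 0.

Lemma unvecK (R : realType) n : cancel (@unvec R n) (@vec R n).
Proof. by move=> d; apply/colP=> k; elim/vec_ind: k => i j; rewrite vecE mxE. Qed.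

Lemma vecBZ (R : realType) n (X Y : 'M[R]_n) e :
  vec (X - e *: Y) = vec X - e *: vec Y.
Proof.
apply/colP=> k; elim/vec_ind: k => i j.
by rewrite [RHS]mxE [X in _ = _ + X]mxE [X in _ = _ - X]mxE !vecE !mxE.
Qed.

Definition balanced (R : realType) n (D : 'M[R]_n) :=
  (forall i, \sum_j D i j = 0) /\ (forall j, \sum_i D i j = 0).

Lemma in_null_vecP (R : realType) n (D : 'M[R]_n) :
  in_null (constraint_mx R n) (vec D) <-> balanced D.
Proof.
rewrite /in_null /constraint_mx /vec mul_col_mx mul_mxrow_mxcol mul_mxblock_mxrow.
have -> : \sum_(j < n) 1%:M *m col j D = \col_i \sum_j D i j.
  by apply/colP=> i; rewrite summxE mxE; apply: eq_bigr => j _; rewrite mul1mx mxE.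
(* Block row [i] of the lower half meets only column [i] of [D]; the product is a 1 by 1 matrix,
   hence written as a scalar matrix. *)
have col_sums i : \sum_(j < n) (if i == j then const_mx 1 else 0 : 'rV[R]_n) *m
    col j D = (\sum_k D k i)%:M.
  rewrite (bigD1 i) //= eqxx big1 => [|j /negPf ji]; last by rewrite eq_sym ji mul0mx.
  apply/rowP=> o; rewrite addr0 !mxE ord1 eqxx mulr1n.
  by apply: eq_bigr => k _; rewrite !mxE mul1r.
split=> [/eqP|[row0 col0]].
  rewrite col_mx_eq0 => /andP[/eqP row0 /eqP col0]; split=> [i|i].
    by move/colP/(_ i): row0; rewrite !mxE.
  move/mxcolP/(_ i): col0; rewrite mxcolK submxcol0 col_sums => /rowP/(_ 0).
  by rewrite !mxE eqxx mulr1n.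
apply/eqP; rewrite col_mx_eq0; apply/andP; split; apply/eqP.
  by apply/colP=> i; rewrite !mxE.
by apply/mxcolP=> i; rewrite mxcolK submxcol0 col_sums col0 raddf0.
Qed.

(** * Cycles of alternating signs in a balanced matrix *)

Lemma conformal_mx_mul_gt0 (R : realType) n (X Y : 'M[R]_n) :
  (forall i j, X i j != 0 -> 0 < X i j * Y i j) -> conformal_mx X Y.
Proof.
move=> XY_gt0; apply/conformalP; split=> k; elim/vec_ind: k => i j; rewrite !vecE.
  by move=> Y0; apply/eqP; apply: contraT => /XY_gt0; rewrite Y0 mulr0 ltxx.
by have [->|/XY_gt0/ltW//] := eqVneq (X i j) 0; rewrite mul0r.
Qed.

Lemma sum_eq0_exists_neg (R : realType) (I : finType) (F : I -> R) i :
  \sum_j F j = 0 -> 0 < F i -> exists j, F j < 0.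
Proof.
move=> sumF0 Fi_gt0; apply/existsP; apply: contraLR Fi_gt0 => /existsPn F_ge0.
have F0 := psumr_eq0P (fun j _ => _ : 0 <= F j) sumF0.
by rewrite F0 ?ltxx // => j; rewrite leNgt.
Qed.

Lemma sum_eq0_exists_pos (R : realType) (I : finType) (F : I -> R) i :
  \sum_j F j = 0 -> F i != 0 -> exists j, 0 < F j.
Proof.
move=> sumF0; rewrite neq_lt => /orP[Fi_lt0|]; last by exists i.
have [||j] := @sum_eq0_exists_neg R I (fun j => - F j) i.
- by rewrite sumrN sumF0 oppr0.
- by rewrite oppr_gt0.
by rewrite oppr_lt0; exists j.
Qed.

Lemma exists_periodic_point (T : finType) (f : T -> T) x :
  exists k t, let y := iter k f x in
    [/\ (0 < t)%N, iter t f y = y & uniq (traject f y t)].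
Proof.
(* The iterate of rank [order f x] repeats the one of rank [k]: [k] is the length of the tail before
   the loop, and the rest of the orbit is the loop. *)
have /trajectP[k lt_k eq_k] := looping_order f x.
exists k, (fingraph.order f x - k)%N; split; first by rewrite subn_gt0.
  by rewrite -iterD subnK ?eq_k 1?ltnW.
have := orbit_uniq f x.
have -> : fingraph.orbit f x = traject f x k ++ traject f (iter k f x) (fingraph.order f x - k).
  by rewrite -trajectD subnKC // ltnW.
by rewrite cat_uniq => /and3P[].
Qed.

(** Appending to [s] the ordinals it misses gives an enumeration of ['I_n] of length [n], which is a
    permutation. *)
Lemma exists_perm_nth n (s : seq 'I_n) :
  uniq s -> exists p : 'S_n, forall (i : 'I_n) x, (i < size s)%N -> p i = nth x s i.
Proof.
move=> uniq_s; pose s' := s ++ [seq x <- enum 'I_n | x \notin s].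
have uniq_s' : uniq s'.
  rewrite cat_uniq uniq_s filter_uniq ?enum_uniq // andbT.
  by apply/hasPn=> x; rewrite mem_filter => /andP[].
have size_s' : size s' = n.
  rewrite -[RHS]card_ord -(card_uniqP uniq_s'); apply: eq_card => x.
  by rewrite mem_cat mem_filter mem_enum !inE andbT orbN.
have inj_s' : injective (fun i : 'I_n => nth i s' i).
  move=> i j; rewrite (set_nth_default i) ?size_s' // => /eqP.
  by rewrite nth_uniq ?size_s' // => /eqP/val_inj.
exists (perm inj_s') => i x lt_i.
by rewrite permE nth_cat lt_i; apply: set_nth_default.
Qed.

(* The columns of the cycle are distinct because the next row is a function of
   the column. *)
Lemma exists_sign_cycle (R : realType) n (D : 'M[R]_n) :
  balanced D -> D != 0 ->
  exists r c : seq 'I_n,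
    [/\ uniq r, uniq c, size c = size r, (1 < size r)%N &
      forall k x, (k < size r)%N ->
        0 < D (nth x r k) (nth x c k) /\
        D (nth x r (if k.+1 == size r then 0 else k.+1)%N) (nth x c k) < 0].
Proof.
move=> [row0 col0] D_neq0; pose P r := [exists c, D r c != 0].
have [x0 Px0] : exists r, P r.
  apply/existsP; apply: contraR D_neq0 => /existsPn D0; apply/eqP/matrixP=> i j.
  by rewrite mxE; apply/eqP; apply: contraR (D0 i) => ?; apply/existsP; exists j.
(* [g] picks a positive column in each nonzero row, and [h] a row with a negative entry in each
   column that has a positive one. Elsewhere their values are arbitrary. *)
have /fin_all_exists[g gP] r : exists c, P r -> 0 < D r c.
  have [/existsP[c Drc]|] := boolP (P r); last by exists r.
  by have [d] := sum_eq0_exists_pos (row0 r) Drc; exists d.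
have /fin_all_exists[h hP] c : exists r, (exists i, 0 < D i c) -> D r c < 0.
  have [[i Dic]|] := pselect (exists i, 0 < D i c); last by exists c.
  by have [r] := sum_eq0_exists_neg (F := D^~ c) (col0 c) Dic; exists r.
pose f := h \o g.
have f_neg r : P r -> D (f r) (g r) < 0.
  by move=> Pr; apply: hP; exists r; exact: gP.
(* The row reached by [f] contains a negative entry, so it is nonzero and the iteration can
   continue. *)
have P_iter k : P (iter k f x0).
  elim: k => //= k /f_neg Df; apply/existsP; exists (g (iter k f x0)).
  by rewrite lt_eqF.
have [k [t [t_gt0]]] := exists_periodic_point f x0.
set y := iter k f x0 => y_fix uniq_r; exists (traject f y t), (map g (traject f y t)).
have Py i : P (iter i f y) by rewrite /y -iterD.
(* On the periodic orbit [f] acts as a rotation of the list. Since [f] factors through [g], the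
   columns are then distinct too. *)
have uniq_fr : uniq (map f (traject f y t)).
  have map_f m z : map f (traject f z m) = traject f (f z) m.
    by elim: m z => //= m IHm z; rewrite IHm.
  rewrite map_f; case: t t_gt0 y_fix uniq_r => // t _ y_fix uniq_r.
  by rewrite trajectSr -iterSr y_fix -rot1_cons rot_uniq -trajectS.
rewrite size_map size_traject; split=> //.
- by move: uniq_fr; rewrite map_comp; apply: map_uniq.
(* A loop of length one would make the entry at [(y, g y)] both positive and negative. *)
- case: t t_gt0 y_fix {uniq_r uniq_fr} => [//|[|//]] _ /= y_fix.
  by have := f_neg y (Py 0%N); rewrite y_fix => /lt_trans/(_ (gP _ (Py 0%N))); rewrite ltxx.
move=> i x lt_i; rewrite (nth_map x) ?size_traject //.
have nth_r m : (m < t)%N -> nth x (traject f y t) m = iter m f y.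
  by move=> lt_m; rewrite (set_nth_default y) ?size_traject // nth_traject.
rewrite !nth_r //; last by case: ifP => // /negbT; rewrite ltn_neqAle lt_i => ->.
split; first exact: gP.
(* At the last index the next row is [iter t f y], that is [y], the row at position 0. *)
case: eqP => [eq_t|_]; last exact: (f_neg _ (Py i)).
by have := f_neg _ (Py i); rewrite -[f _]/(iter i.+1 f y) eq_t y_fix.
Qed.

(** * Cycle matrices and their permuted copies *)

Lemma sum_pred1 (R : realType) (I : finType) (a : I) :
  \sum_i (i == a)%:R = 1 :> R.
Proof. by rewrite (bigD1 a) //= eqxx big1 ?addr0 // => i /negPf ->. Qed.

(** Each row of index below [t] is a difference of two indicators, at [i] and at its cyclic
    predecessor modulo [t]; for columns the successor replaces the predecessor. All other lines are
    zero. *)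
Lemma cycle_mx_balanced (R : realType) n t :
  (2 <= t <= n)%N -> balanced (cycle_mx R n t).
Proof.
case/andP=> t_ge2 t_le; split=> i.
  have [ge_i|lt_i] := leqP t i.
    by apply: big1 => j _; rewrite mxE -val_eqE /=; do 3!(case: ifP; first lia).
  have lt_p : ((if i == 0%N :> nat then t.-1 else i.-1) < n)%N by case: ifP; lia.
  rewrite (eq_bigr (fun j => (j == i)%:R - (j == Ordinal lt_p)%:R)).
    by rewrite sumrB !sum_pred1 subrr.
  move=> j _; rewrite mxE -!val_eqE /=.
  by do ![case: ifP | case: eqP]; rewrite ?subr0 ?sub0r //; lia.
have [ge_i|lt_i] := leqP t i.
  by apply: big1 => j _; rewrite mxE -val_eqE /=; do 3!(case: ifP; first lia).
have lt_s : ((if i.+1 == t then 0%N else i.+1) < n)%N by case: ifP; lia.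
rewrite (eq_bigr (fun j => (j == i)%:R - (j == Ordinal lt_s)%:R)).
  by rewrite sumrB !sum_pred1 subrr.
move=> j _; rewrite mxE -!val_eqE /=.
by do ![case: ifP | case: eqP]; rewrite ?subr0 ?sub0r //; lia.
Qed.

Lemma balanced_perm (R : realType) n (p q : 'S_n) (X : 'M[R]_n) :
  balanced X -> balanced (row_perm p (col_perm q X)).
Proof.
move=> [row0 col0]; split=> i.
  rewrite -[RHS](row0 (p i)) [RHS](reindex_inj (@perm_inj _ q)).
  by apply: eq_bigr => j _; rewrite !mxE.
rewrite -[RHS](col0 (q i)) [RHS](reindex_inj (@perm_inj _ p)).
by apply: eq_bigr => j _; rewrite !mxE.
Qed.

(** The permutations extend the row and column lists of a sign cycle of [D], so that the entries 1
    land on positive entries of [D] and the entries -1 on negative ones. *)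
Lemma exists_conformal_cycle (R : realType) n (D : 'M[R]_n) :
  balanced D -> D != 0 ->
  exists t (p q : 'S_n) (C : 'M[R]_n),
    [/\ (2 <= t <= n)%N, row_perm p (col_perm q C) = cycle_mx R n t,
        C != 0, balanced C & conformal_mx C D].
Proof.
move=> balD D_neq0.
have [r [c [uniq_r uniq_c size_c size_r sgnD]]] := exists_sign_cycle balD D_neq0.
have [p pE] := exists_perm_nth uniq_r; have [q qE] := exists_perm_nth uniq_c.
rewrite size_c in qE; set t := size r in size_r sgnD pE qE.
have le_t : (t <= n)%N by rewrite -[n]card_ord /t -(card_uniqP uniq_r) max_card.
pose C : 'M[R]_n := row_perm p^-1 (col_perm q^-1 (cycle_mx R n t)).
have CE : row_perm p (col_perm q C) = cycle_mx R n t.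
  by apply/matrixP=> i j; rewrite !mxE !permK.
have t_bounds : (2 <= t <= n)%N by rewrite size_r.
exists t, p, q, C; split=> //.
(* The top left entry of [cycle_mx] is 1, so [C] cannot vanish. *)
- have n_gt0 : (0 < n)%N by lia.
  pose o := Ordinal n_gt0.
  apply: contraTneq (oner_neq0 R) => C0; rewrite negbK; apply/eqP.
  move/matrixP/(_ o o): CE; rewrite C0 !mxE eqxx /= => ->.
  by rewrite (ltnW size_r).
- exact/balanced_perm/cycle_mx_balanced.
apply: conformal_mx_mul_gt0 => i j.
(* With the indices written as images under [p] and [q], the entry of [C] is that of [cycle_mx]. The
   nonzero cases are the diagonal, the subdiagonal and the corner, which closes the cycle. *)
rewrite !mxE -(permKV p i) -(permKV q j) !permK.
move: (p^-1 i)%g (q^-1 j)%g => {}i {}j.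
have [->|_] /= := eqVneq i j.
  case: ifP => [lt_j _|].
    by rewrite mul1r (pE _ j) // (qE _ j) //; case: (sgnD j j lt_j).
  by move=> /negbT ge_j; do 2!(case: ifP; first lia); rewrite eqxx.
case: ifP => [/andP[/eqP eq_i lt_j] _|_].
  have [_] := sgnD j j (ltnW lt_j).
  by rewrite ltn_eqF // -eq_i mulN1r oppr_gt0 (pE _ j) ?(qE _ j) ?eq_i // ltnW.
case: ifP => [/andP[/eqP eq_i /eqP eq_j] _|]; last by rewrite eqxx.
have lt_j : (j < t)%N by rewrite -eq_j.
have [_] := sgnD j j lt_j.
by rewrite eq_j eqxx -eq_i mulN1r oppr_gt0 (pE _ j) ?(qE _ j) ?eq_i // ltnW.
Qed.

(** * Elementary matrices as permuted cycles, and the decomposition of matrices *)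

Lemma elementary_in_cycle_family (R : realType) n (X : 'M[R]_n) :
  elementary_matrix X -> in_cycle_family X.
Proof.
move=> [X_neq0 [_ /in_null_vecP balX minX]]; split=> //.
have [t [p [q [C [t_bounds CE C_neq0 balC confC]]]]] :=
  exists_conformal_cycle balX X_neq0.
have vecC_neq0 : vec C != 0 by rewrite -vec0 (inj_eq (@vec_inj _ _)).
(* The entry [k] is killed by the subtraction; it shows that the supports differ, which contradicts
   minimality unless the difference is zero. *)
have [e _ [confXC /properP[_ [k kX kXC]]]] := conformal_sub vecC_neq0 confC.
exists t, p, q, e; split=> //.
have [|XC_neq0] := eqVneq (vec X - e *: vec C) 0.
  rewrite -vecBZ -vec0 => /vec_inj/eqP; rewrite subr_eq0 => /eqP ->.
  by rewrite -CE; apply/matrixP=> i j; rewrite !mxE.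
case: minX; exists (vec X - e *: vec C); split=> //.
  by apply: in_nullB; apply/in_null_vecP.
by apply: contraNneq kXC => ->.
Qed.

Theorem theorem3 (R : realType) (n : nat) (hn : (2 <= n)%N) :
  (forall D : 'M[R]_n, in_null (constraint_mx R n) (vec D) ->
     exists (s : nat) (Ds : 'I_s -> 'M[R]_n),
       [/\ D = \sum_(i < s) Ds i,
           forall i, elementary_matrix (Ds i) /\ conformal_mx (Ds i) D,
           D = 0 -> s = 0%N &
           forall i, in_cycle_family (Ds i)])
  /\ (forall X : 'M[R]_n, elementary_matrix X -> in_cycle_family X).
Proof.
split=> [D D_null|X]; last exact: elementary_in_cycle_family.
have [xs [sum_xs xs_elem xs_nil]] := conformal_realization D_null.
have unvec_elem (i : 'I_(size xs)) : elementary_matrix (unvec xs`_i).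
  have [elem_i _] := xs_elem _ (mem_nth 0 (ltn_ord i)).
  split; last by rewrite unvecK.
  by case: elem_i => + _ _; apply: contraNneq => ui0; rewrite -(unvecK xs`_i) ui0 vec0.
exists (size xs), (fun i => unvec xs`_i); split=> [|i|D0|i].
(* The decomposition is known for [vec D], so the matrices are compared through their
   vectorizations, entry by entry. *)
- apply/vec_inj/colP=> k; elim/vec_ind: k => i j.
  rewrite sum_xs (big_nth 0) big_mkord !summxE vecE summxE.
  by apply: eq_bigr => l _; rewrite mxE.
- split=> //; have [_] := xs_elem _ (mem_nth 0 (ltn_ord i)).
  by rewrite /conformal_mx unvecK.
- by rewrite xs_nil // D0 vec0.
exact/elementary_in_cycle_family/unvec_elem.
Qed.
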